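(* Let $\mathcal{C}$ be a permutation class. Then $\mathcal{C}$ is griddable if and only if $\mathcal{C}$ contains neither arbitrarily long direct sums of $21$ nor arbitrarily long skew sums of $12$; that is, if and only if there is an integer $a\ge 1$ such that the $a$-fold skew sum $12\ominus 12\ominus\cdots\ominus 12$ is not in $\mathcal{C}$, and there is an integer $b\ge 1$ such that the $b$-fold direct sum $21\oplus 21\oplus\cdots\oplus 21$ is not in $\mathcal{C}$.
   Context: Write $[n]=\{1,\dots,n\}$ and let $S_n$ be the set of permutations of $[n]$, written in one-line notation. A permutation $\pi\in S_n$ contains $\sigma\in S_k$ (written $\sigma\le\pi$) if $\pi$ has a subsequence of length $k$ in the same relative order as $\sigma$. A permutation class is a set $\mathcal{C}$ of permutations such that $\pi\in\mathcal{C}$ and $\sigma\le\pi$ imply $\sigma\in\mathcal{C}$. For $\pi\in S_m$ and $\sigma\in S_n$, the direct sum $\pi\oplus\sigma\in S_{m+n}$ is given by $(\pi\oplus\sigma)(i)=\pi(i)$ for $i\in[m]$ and $(\pi\oplus\sigma)(i)=\sigma(i-m)+m$ for $i\in[m+n]\setminus[m]$. The skew sum $\pi\ominus\sigma\in S_{m+n}$ is given by $(\pi\ominus\sigma)(i)=\pi(i)+n$ for $i\in[m]$ and $(\pi\ominus\sigma)(i)=\sigma(i-m)$ for $i\in[m+n]\setminus[m]$. For $\pi\in S_n$ and $A,B\subseteq[n]$, $\pi(A\times B)$ denotes the subsequence of $\pi$ consisting of the entries $\pi(i)$ with $i\in A$ and $\pi(i)\in B$. Empty and one-term sequences count as both increasing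 and decreasing. A $t\times u$ matrix $M$ means a matrix with entries in $\{0,1,-1\}$ having $t$ columns and $u$ rows, where $M_{k,\ell}$ is the entry in the $k$th column from the left and the $\ell$th row from the bottom. An $M$-gridding of $\pi\in S_n$ is a pair of integer sequences $1=c_1\le c_2\le\cdots\le c_{t+1}=n+1$ and $1=r_1\le r_2\le\cdots\le r_{u+1}=n+1$ such that for all $k\in[t]$, $\ell\in[u]$, the subsequence $\pi([c_k,c_{k+1})\times[r_\ell,r_{\ell+1}))$ is increasing if $M_{k,\ell}=1$, decreasing if $M_{k,\ell}=-1$, and empty if $M_{k,\ell}=0$. (Here $[a,b)=\{a,a+1,\dots,b-1\}$.) A permutation is $t\times u$-griddable if it has an $M$-gridding for some $t\times u$ matrix $M$. A class $\mathcal{C}$ is $t\times u$-griddable if every permutation in $\mathcal{C}$ is $t\times u$-griddable, and it is griddable if it is $t\times u$-griddable for some positive integers $t,u$. *)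

(* Defs.v *)
From mathcomp Require Import all_boot all_fingroup all_algebra.

Set Implicit Arguments.
Unset Strict Implicit.
Unset Printing Implicit Defensive.

(* [n] is represented by 'I_n = {0, ..., n-1}, so positions, values and grid
   lines are all shifted down by one. *)

Definition perm_contains k n (sigma : 'S_k) (pi : 'S_n) : Prop :=
  exists f : 'I_k -> 'I_n,
    (forall i j : 'I_k, i < j -> f i < f j) /\
    (forall i j : 'I_k, (sigma i < sigma j) = (pi (f i) < pi (f j))).

Definition permset := forall n : nat, 'S_n -> Prop.

Definition perm_class (C : permset) : Prop :=
  forall k n (sigma : 'S_k) (pi : 'S_n),
    C n pi -> perm_contains sigma pi -> C k sigma.

Section Sums.
Variables (m n : nat) (pi : 'S_m) (sigma : 'S_n).

Definition dsum_fun (i : 'I_(m + n)) : 'I_(m + n) :=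
  match split i with
  | inl j => lshift n (pi j)
  | inr j => rshift m (sigma j)
  end.

Definition ssum_fun (i : 'I_(m + n)) : 'I_(m + n) :=
  cast_ord (addnC n m)
    match split i with
    | inl j => rshift n (pi j)
    | inr j => lshift m (sigma j)
    end.

Lemma dsum_fun_inj : injective dsum_fun.
Proof.
move=> x y; rewrite /dsum_fun.
case: (split_ordP x) => j ->; case: (split_ordP y) => k -> /eqP.
- by rewrite eq_lshift => /eqP /perm_inj ->.
- by rewrite eq_lrshift.
- by rewrite eq_rlshift.
- by rewrite eq_rshift => /eqP /perm_inj ->.
Qed.

Lemma ssum_fun_inj : injective ssum_fun.
Proof.
move=> x y /cast_ord_inj.
case: (split_ordP x) => j ->; case: (split_ordP y) => k -> /eqP.
- by rewrite eq_rshift => /eqP /perm_inj ->.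
- by rewrite eq_rlshift.
- by rewrite eq_lrshift.
- by rewrite eq_lshift => /eqP /perm_inj ->.
Qed.

Definition dsum : 'S_(m + n) := perm dsum_fun_inj.
Definition ssum : 'S_(m + n) := perm ssum_fun_inj.

End Sums.

(* The 0-fold sum is the empty permutation; a.+1 * m is convertible to
   m + a * m. *)
Fixpoint dsum_iter m (pi : 'S_m) (a : nat) : 'S_(a * m) :=
  match a return 'S_(a * m) with
  | 0 => 1%g
  | a'.+1 => dsum pi (dsum_iter pi a')
  end.

Fixpoint ssum_iter m (pi : 'S_m) (a : nat) : 'S_(a * m) :=
  match a return 'S_(a * m) with
  | 0 => 1%g
  | a'.+1 => ssum pi (ssum_iter pi a')
  end.

Definition perm12 : 'S_2 := 1%g.
Definition perm21 : 'S_2 := tperm ord0 ord_max.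

(* The subsequence pi(A x B), as the list of its values. *)
Definition subseq_perm n (pi : 'S_n) (A B : {set 'I_n}) : seq nat :=
  [seq val (pi i) | i <- enum 'I_n & (i \in A) && (pi i \in B)].

Definition increasing_seq (s : seq nat) : bool := sorted ltn s.
Definition decreasing_seq (s : seq nat) : bool := sorted gtn s.

Definition ord_itv n (a b : nat) : {set 'I_n} := [set i : 'I_n | a <= i < b].

(* Gridding matrices are indexed in Cartesian fashion: M k l is the entry in
   column k (from the left) and row l (from the bottom), so a matrix with t
   columns and u rows has type 'M_(t, u). *)
Definition gridding_mx t u (M : 'M[int]_(t, u)) : Prop :=
  forall k l, M k l \in [:: 0; 1; -1]%R.

Definition grid_lines n t (c : t.+1.-tuple nat) : Prop :=
  [/\ nth 0 c 0 = 0, nth 0 c t = n & sorted leq c].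

Definition is_gridding t u (M : 'M[int]_(t, u)) n (pi : 'S_n)
    (c : t.+1.-tuple nat) (r : u.+1.-tuple nat) : Prop :=
  [/\ grid_lines n c, grid_lines n r &
    forall (k : 'I_t) (l : 'I_u),
      let s := subseq_perm pi (ord_itv n (nth 0 c k) (nth 0 c k.+1))
                              (ord_itv n (nth 0 r l) (nth 0 r l.+1)) in
      [/\ M k l = 1%R -> increasing_seq s,
          M k l = (-1)%R -> decreasing_seq s &
          M k l = 0%R -> s = [::]]].

Definition perm_griddable (t u n : nat) (pi : 'S_n) : Prop :=
  exists M : 'M[int]_(t, u), gridding_mx M /\
    exists (c : t.+1.-tuple nat) (r : u.+1.-tuple nat), is_gridding M pi c r.

Definition class_tu_griddable (t u : nat) (C : permset) : Prop :=
  forall n (pi : 'S_n), C n pi -> perm_griddable t u pi.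

Definition class_griddable (C : permset) : Prop :=
  exists t u : nat, [/\ 0 < t, 0 < u & class_tu_griddable t u C].

(* Main.v *)
Require Import Defs.
From mathcomp Require Import all_boot all_fingroup all_algebra.
From mathcomp Require Import zify.

(** Call a box of positions and values nonmonotone for a permutation when the
    entries inside it contain both a 12 and a 21; a gridding is a choice of
    lines for which no cell is nonmonotone.

    Long sums obstruct griddings by pigeonhole.  If two first entries of
    copies of 12 in a long skew sum share a cell, then every copy between them
    lies wholly in that cell, which then contains both a 12 and a 21.  The
    same holds for direct sums of 21 ([griddable_monotone_box]).

    Conversely, suppose that a permutation contains neither the a-fold skew
    sum of 12 nor the b-fold direct sum of 21, and put N = 2 ^ (b + a).  A
    family of nonmonotone boxes that are pairwise disjoint in both projections
    has fewer than N members: N of them, listed from left to right, would by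
    the theorem of Erdos and Szekeres include b that go up or a that go down
    ([ramsey_pairwise]); the 21s in the former form a direct sum, the 12s in
    the latter a skew sum.  It remains to slice all nonmonotone boxes by
    boundedly many lines, a case of the theorem of Gyarfas and Lehel on
    rectangles without large independent sets.

    The slicing is greedy ([chain_or_slicing]) and is run twice.  Within a
    horizontal strip, either there are N column-disjoint nonmonotone boxes, or
    2N vertical lines slice every nonmonotone box of the strip.  Applied to
    the strips themselves, the first alternative being the bad case, the same
    argument yields either N disjoint bad strips, or 2N strips that are all
    good.  In the second case the lines of all the good strips together form a
    gridding.  In the first, one box can be picked from each of the N strips
    so that the picked boxes are disjoint in columns as well
    ([rainbow_chain]), which contradicts the bound on independent boxes. *)

Set Implicit Arguments.
Unset Strict Implicit.
Unset Printing Implicit Defensive.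

(** * Sums of 12 and of 21, entry by entry *)

Lemma ssum_iter12E a (x : 'I_(a * 2)) :
  ssum_iter perm12 a x = (a - x./2.+1) * 2 + odd x :> nat.
Proof.
elim: a x => [|a IH] x; first by case: x.
change (nat_of_ord (@ssum 2 (a * 2) perm12 (ssum_iter perm12 a) x) =
  (a.+1 - x./2.+1) * 2 + odd x).
rewrite permE /ssum_fun.
case: (@split_ordP 2 (a * 2) x) => j -> /=; last first.
  by rewrite IH; lia.
by rewrite perm1; case: j => [[|[|m]] hm] //=; lia.
Qed.

Lemma dsum_iter21E a (x : 'I_(a * 2)) :
  dsum_iter perm21 a x = x./2 * 2 + ~~ odd x :> nat.
Proof.
elim: a x => [|a IH] x; first by case: x.
change (nat_of_ord (@dsum 2 (a * 2) perm21 (dsum_iter perm21 a) x) =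
  x./2 * 2 + ~~ odd x).
rewrite permE /dsum_fun.
case: (@split_ordP 2 (a * 2) x) => j -> /=; last by rewrite IH; lia.
case: j => [[|[|m]] hm] //=.
  by rewrite (_ : Ordinal hm = ord0) ?tpermL //; apply: val_inj.
by rewrite (_ : Ordinal hm = ord_max) ?tpermR //; apply: val_inj.
Qed.

(** * Monotone cells of a gridding *)

Lemma pairwise_or_sym (T : eqType) (R : rel T) s p q :
  pairwise R s -> p \in s -> q \in s -> p != q -> R p q || R q p.
Proof.
elim: s => //= x s IH /andP[/allP hx hs]; rewrite !inE.
case/orP=> [/eqP -> | hp]; case/orP=> [/eqP -> | hq]; rewrite ?eqxx //.
- by rewrite hx.
- by rewrite hx ?orbT.
- exact: IH.
Qed.

Lemma subseq_perm_sorted n (pi : 'S_n) (A B : {set 'I_n}) (R : rel nat) :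
  transitive R ->
  reflect (forall p q : 'I_n, p \in A -> q \in A -> pi p \in B -> pi q \in B ->
             p < q -> R (pi p) (pi q))
          (sorted R (subseq_perm pi A B)).
Proof.
move=> trR; rewrite sorted_pairwise // /subseq_perm pairwise_map.
set s := filter _ _.
have lts : pairwise (fun p q : 'I_n => p < q) s.
  rewrite -(pairwise_map val ltn) -sorted_pairwise; last exact: ltn_trans.
  apply: (subseq_sorted ltn_trans (s2 := map val (enum 'I_n))).
    exact/map_subseq/filter_subseq.
  by rewrite val_enum_ord iota_ltn_sorted.
have mem_s p : (p \in s) = (p \in A) && (pi p \in B).
  by rewrite mem_filter mem_enum andbT.
apply: (iffP idP) => [hR p q pA qA pB qB lpq | hR].
  have /pairwise_or_sym : pairwise
      (fun p q : 'I_n => (p < q) && R (pi p) (pi q)) s.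
    by rewrite pairwise_relI lts.
  move=> /(_ p q); rewrite !mem_s pA qA pB qB -val_eqE neq_ltn /= lpq.
  by move=> /(_ isT isT isT)/orP[] // /andP[]; rewrite ltnNge ltnW.
apply: (sub_in_pairwise (P := mem s)) lts; last by apply/allP => x.
move=> p q; rewrite /= !mem_s => /andP[? ?] /andP[? ?]; exact: hR.
Qed.

Lemma grid_lines_cover n t (c : t.+1.-tuple nat) (p : 'I_n) :
  grid_lines n c -> exists k : 'I_t, p \in ord_itv n (nth 0 c k) (nth 0 c k.+1).
Proof.
case=> c0 ct _.
have ex : exists k, p < nth 0 c k by exists t; rewrite ct.
case: (ex_minnP ex) => [[|k]]; rewrite ?c0 // => lt_p min_k.
have kt : k < t.
  by apply: min_k; rewrite ct.
exists (Ordinal kt); rewrite inE /= lt_p andbT leqNgt.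
by apply/negP => /min_k; rewrite ltnn.
Qed.

(** Pigeonhole on the cells: two of the points g m share a cell, and cells are
    convex, so the whole bounding box of these two points is monotone. *)
Lemma griddable_monotone_box t u n (pi : 'S_n) (g : 'I_(t * u).+1 -> 'I_n) :
  perm_griddable t u pi ->
  exists i j : 'I_(t * u).+1, i < j /\ exists2 R : rel nat, R = ltn \/ R = gtn &
    forall p q : 'I_n, p < q ->
      (forall x, x \in [:: p; q] ->
         (minn (g i) (g j) <= x <= maxn (g i) (g j)) /\
         (minn (pi (g i)) (pi (g j)) <= pi x <= maxn (pi (g i)) (pi (g j)))) ->
      R (pi p) (pi q).
Proof.
case=> M [hM [c [r [hc hr hcell]]]].
pose C k := ord_itv n (nth 0 c k) (nth 0 c k.+1).
pose D l := ord_itv n (nth 0 r l) (nth 0 r l.+1).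
have /fin_all_exists[h hh] (m : 'I_(t * u).+1) :
    exists kl : 'I_t * 'I_u, g m \in C kl.1 /\ pi (g m) \in D kl.2.
  have [k hk] := grid_lines_cover (g m) hc.
  have [l hl] := grid_lines_cover (pi (g m)) hr.
  by exists (k, l).
have [i [j [lij hij]]] : exists i j : 'I_(t * u).+1, i < j /\ h i = h j.
  have /injectivePn[i [j nij hij]] : ~~ injectiveb h.
    by apply/negP => /injectiveP/leq_card; rewrite card_prod !card_ord ltnn.
  case: (ltngtP i j) => // [lij | lji | /val_inj eij].
  - by exists i, j.
  - by exists j, i.
  - by rewrite eij eqxx in nij.
exists i, j; split=> //.
case: (hh i) (hh j); rewrite -hij => ci di [cj dj].
have {}hcell := hcell (h i).1 (h i).2; simpl in hcell; move: hcell.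
rewrite -/(C _) -/(D _) => -[h1 h2 h0].
have hull R : transitive R -> sorted R (subseq_perm pi (C (h i).1) (D (h i).2)) ->
    forall p q : 'I_n, p < q ->
      (forall x, x \in [:: p; q] ->
         (minn (g i) (g j) <= x <= maxn (g i) (g j)) /\
         (minn (pi (g i)) (pi (g j)) <= pi x <= maxn (pi (g i)) (pi (g j)))) ->
      R (pi p) (pi q).
  move=> trR /(subseq_perm_sorted _ _ _ trR) hs p q lpq hpq.
  move: ci di cj dj; rewrite !inE => ci di cj dj.
  have [hp1 hp2] := hpq p (mem_head _ _).
  have [hq1 hq2] : (minn (g i) (g j) <= q <= maxn (g i) (g j)) /\
         (minn (pi (g i)) (pi (g j)) <= pi q <= maxn (pi (g i)) (pi (g j))).
    by apply: hpq; rewrite !inE eqxx orbT.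
  by apply: hs => //; rewrite inE; lia.
have := hM (h i).1 (h i).2; rewrite !inE => /or3P[] /eqP e.
- exists ltn; first by left.
  by apply: hull; [exact: ltn_trans | rewrite h0].
- exists ltn; first by left.
  by apply: hull; [exact: ltn_trans | exact: h1].
- exists gtn; first by right.
  apply: hull; last exact: h2.
  by move=> x y z; rewrite /= => h3 h4; exact: ltn_trans h4 h3.
Qed.

(** Only the even-numbered copies of 12 are fed to the pigeonhole, so that the
    odd-numbered copy next to the first of the two points found lies strictly
    inside their bounding box.  The first point precedes and exceeds both
    entries of that copy, so the box contains a 21 as well as a 12. *)
Lemma ssum_iter12_not_griddable t u a :
  2 * (t * u).+1 <= a -> ~ perm_griddable t u (ssum_iter perm12 a).
Proof.
move=> ha.
have P (m : 'I_(t * u).+1) e : e < 4 -> 4 * m + e < a * 2.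
  by case: m => m /= hm; lia.
pose g m := Ordinal (@P m 0 isT).
case/(griddable_monotone_box g) => i [j [lij [R hR mono]]].
pose p0 := g i; pose p1 := Ordinal (@P i 2 isT); pose p2 := Ordinal (@P i 3 isT).
have lt_j : j < (t * u).+1 by [].
have E := @ssum_iter12E a.
have m1 := mono p0 p1; have m2 := mono p1 p2.
case: hR => hR; subst R.
- have : ltn (ssum_iter perm12 a p0) (ssum_iter perm12 a p1).
    apply: m1; first by rewrite /=; lia.
    by move=> x; rewrite !inE => /orP[] /eqP ->; rewrite !E /=; lia.
  by rewrite /= !E /=; lia.
- have : gtn (ssum_iter perm12 a p1) (ssum_iter perm12 a p2).
    apply: m2; first by rewrite /=; lia.
    by move=> x; rewrite !inE => /orP[] /eqP ->; rewrite !E /=; lia.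
  by rewrite /= !E /=; lia.
Qed.

Lemma dsum_iter21_not_griddable t u b :
  2 * (t * u).+1 <= b -> ~ perm_griddable t u (dsum_iter perm21 b).
Proof.
move=> hb.
have P (m : 'I_(t * u).+1) e : e < 4 -> 4 * m + e < b * 2.
  by case: m => m /= hm; lia.
pose g m := Ordinal (@P m 0 isT).
case/(griddable_monotone_box g) => i [j [lij [R hR mono]]].
pose p0 := g i; pose p1 := Ordinal (@P i 2 isT); pose p2 := Ordinal (@P i 3 isT).
have lt_j : j < (t * u).+1 by [].
have E := @dsum_iter21E b.
have m1 := mono p0 p1; have m2 := mono p1 p2.
case: hR => hR; subst R.
- have : ltn (dsum_iter perm21 b p1) (dsum_iter perm21 b p2).
    apply: m2; first by rewrite /=; lia.
    by move=> x; rewrite !inE => /orP[] /eqP ->; rewrite !E /=; lia.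
  by rewrite /= !E /=; lia.
- have : gtn (dsum_iter perm21 b p0) (dsum_iter perm21 b p1).
    apply: m1; first by rewrite /=; lia.
    by move=> x; rewrite !inE => /orP[] /eqP ->; rewrite !E /=; lia.
  by rewrite /= !E /=; lia.
Qed.

(** * Greedy slicing *)

Fixpoint chain (P : nat -> nat -> Prop) (a : nat) (w : seq (nat * nat)) : Prop :=
  if w is J :: w' then [/\ a <= J.1, P J.1 J.2 & chain P J.2 w'] else True.

(** Repeated cuts are allowed, which lets the number of cuts be prescribed
    exactly. *)
Fixpoint slicing (G : nat -> nat -> Prop) (a : nat) (s : seq nat) (n : nat) :
    Prop :=
  if s is x :: s' then [/\ a <= x, G a x & slicing G x s' n] else a = n.

Lemma first_bad_end (P G : nat -> nat -> Prop) a n :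
  (forall x y, P x y -> x.+1 < y) ->
  (forall x y, x <= y -> P x y \/ G x y) ->
  P a n -> exists e, [/\ a < e, e.+1 <= n, P a e.+1 & G a e].
Proof.
move=> P_long P_or_G; elim: n => [/P_long // | n IH Pan].
have lan := P_long _ _ Pan.
have [/IH[e [? ? ? ?]] | Gan] := P_or_G a n (ltnW lan); exists e || exists n.
  by split=> //; lia.
by [].
Qed.

(** P stands for bad and G for good intervals.  The first end e.+1 for which
    the interval from a is bad contributes an interval to the chain, and the
    two cuts e and e.+1 to the slicing: the interval up to e is good by
    minimality, the one from e to e.+1 because it is too short to be bad.  The
    dichotomy is a hypothesis, rather than G being the negation of P, so that
    the conclusion for one direction can serve as the dichotomy for the other
    direction. *)
Lemma chain_or_slicing (P G : nat -> nat -> Prop) N a n :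
  (forall x y, P x y -> x.+1 < y) ->
  (forall x y, x <= y -> P x y \/ G x y) -> a <= n ->
  (exists2 w, size w = N & chain P a w) \/
  (exists2 s, size s = N * 2 & slicing G a s n).
Proof.
move=> P_long P_or_G.
have G_short x y : x <= y <= x.+1 -> G x y.
  by move=> /andP[/P_or_G[/P_long|//]]; lia.
elim: N a => [|N IH] a lan; first by left; exists [::].
have [/(first_bad_end P_long P_or_G)[e [lae len Pae Gae]] | Gan] := P_or_G _ _ lan.
- have [[w sw cw] | [s ss cs]] := IH _ len.
  + by left; exists ((a, e.+1) :: w); rewrite /= ?sw.
  + right; exists [:: e, e.+1 & s]; rewrite /= ?ss //.
    by split; [lia | | split=> //; apply: G_short; lia].
(* No bad interval starts at a: the cuts are padded with copies of n. *)
- right; exists (nseq (N.+1 * 2) n); first by rewrite size_nseq.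
  rewrite mulSn /=; split=> //.
  have Gnn : G n n by apply: G_short; lia.
  by split=> //; elim: (N * 2) => //= m IHm; split.
Qed.

(** An interval that no cut separates lies in one piece of the slicing; this is
    how a cell of the final grid, refined by the cuts of all the strips, is
    located within the slicing of its own strip. *)
Lemma slicing_sub (G : nat -> nat -> Prop) a s n x y :
  slicing G a s n -> a <= x -> x < y -> y <= n ->
  (forall z, z \in s -> z <= x \/ y <= z) ->
  exists b c, [/\ G b c, b <= x & y <= c].
Proof.
elim: s a => [|z s IH] a /=; first by move=> -> ? ? ?; lia.
case=> laz Gaz cs lax lxy lyn hs.
case: (hs z (mem_head _ _)) => hz; last by exists a, z.
by apply: IH cs hz _ _ _ => // t ts; apply: hs; rewrite inE ts orbT.
Qed.

Lemma slicing_grid G a s n :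
  slicing G a s n -> [/\ path leq a s, last a s = n &
    forall i, i < size s -> G (nth 0 (a :: s) i) (nth 0 s i)].
Proof.
elim: s a => [|x s IH] a //= [lax Gax /IH[p l h]]; split=> //.
- by rewrite lax.
- by case=> [|i] //= /h.
Qed.

Lemma slicing_le G a s n z : slicing G a s n -> z \in s -> z <= n.
Proof.
elim: s a => //= x s IH a [lax _ cs].
rewrite inE => /orP[/eqP -> | ]; last exact: IH cs.
elim: s x {IH lax} cs => /= [x -> // | y s IH x [lxy _ /IH]]; exact: leq_trans.
Qed.

(** * Selecting disjoint intervals *)

(** The bound for sequences due to Erdos and Szekeres, in a weaker exponential
    form with an induction as in the theorem of Ramsey: the head of s is
    related to half of the tail or unrelated to half of it, and it extends the
    sequence found in that half. *)
Lemma ramsey_pairwise (T : eqType) (r : rel T) a b s :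
  2 ^ (a + b) <= size s ->
  (exists t, [/\ size t = a, pairwise r t & subseq t s]) \/
  (exists t, [/\ size t = b, pairwise (fun x y => ~~ r x y) t & subseq t s]).
Proof.
elim: {s}(size s) {-2}s (leqnn (size s)) a b => [|m IH] s.
  by rewrite leqn0 => /eqP -> a b; rewrite leqn0 expn_eq0.
case: s => [|x s] sm [|a] [|b] hs; try by left; exists [::]; rewrite ?sub0seq.
1,2: by rewrite leqNgt expn_gt0 in hs.
- by right; exists [::]; rewrite ?sub0seq.
have le_filter p : size (filter p s) <= m.
  by rewrite size_filter (leq_trans (count_size _ _)).
have := count_predC (r x) s; rewrite -!size_filter => sz.
have split_pow : 2 ^ (a.+1 + b.+1) = 2 ^ (a + b.+1) * 2 by rewrite addSn expnSr.
have pow_eq : 2 ^ (a.+1 + b) = 2 ^ (a + b.+1) by rewrite addSnnS.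
have grow (p : pred T) t : subseq t (filter p s) ->
    all p t /\ subseq (x :: t) (x :: s).
  move=> /[dup] /mem_subseq sub_t /subseq_trans/(_ (filter_subseq p s)) ts.
  split; last by rewrite /= eqxx.
  by apply/allP => y /sub_t; rewrite mem_filter => /andP[].
have weaken p t : subseq t (filter p s) -> subseq t (x :: s).
  move=> h; apply: subseq_trans h _; apply: subseq_trans (filter_subseq p s) _.
  exact: subseq_cons.
move: hs; rewrite /= split_pow => hs.
have [le_r | gt_r] := leqP (2 ^ (a + b.+1)) (size (filter (r x) s)).
- have [[t [st pt /grow[rt ts]]] | [t [st pt /weaken ts]]] :=
    IH _ (le_filter _) _ _ le_r.
  + by left; exists (x :: t); split=> //=; rewrite ?st ?rt.
  + by right; exists t.
- have le_nr : 2 ^ (a.+1 + b) <= size (filter (predC (r x)) s) by lia.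
  have [[t [st pt /weaken ts]] | [t [st pt /grow[rt ts]]]] :=
    IH _ (le_filter _) _ _ le_nr.
  + by left; exists t.
  + by right; exists (x :: t); split=> //=; rewrite ?st ?rt.
Qed.

Lemma chain_weaken P a a' w : a' <= a -> chain P a w -> chain P a' w.
Proof. by case: w => //= J w laa [h ? ?]; split=> //; exact: leq_trans h. Qed.

Lemma chain_pairwise (P : nat -> nat -> Prop) a w :
  (forall x y, P x y -> x <= y) -> chain P a w ->
  [/\ all (fun J => a <= J.1) w, pairwise (fun J J' => J.2 <= J'.1) w &
      forall J, J \in w -> P J.1 J.2].
Proof.
move=> hP; elim: w a => [|J w IH] a //= [laJ PJ /IH[lo pw Pw]]; split.
- rewrite laJ; apply: sub_all lo => J'; apply: leq_trans.
  exact: leq_trans laJ (hP _ _ PJ).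
- by rewrite lo.
- by move=> J'; rewrite inE => /orP[/eqP -> | /Pw].
Qed.

Lemma exists_minimal_value (T : eqType) (H : T -> nat -> Prop) (s : seq T) :
  s <> [::] -> (forall x, x \in s -> exists v, H x v) ->
  exists x v, [/\ x \in s, H x v &
    forall y, y \in s -> exists2 v', H y v' & v <= v'].
Proof.
elim: s => // x s IH _ hs.
have [v hv] := hs x (mem_head _ _).
case: s => [|x' s] in IH hs *.
  exists x, v; rewrite mem_head; split=> // y; rewrite inE => /eqP ->.
  by exists v.
have [|y ys|y [v' [ys hy min_y]]] := IH.
- by [].
- by apply: hs; rewrite inE ys orbT.
have [lvv | lvv] := leqP v v'.
- exists x, v; rewrite mem_head; split=> // z; rewrite inE => /orP[/eqP -> | ].
    by exists v.
  by case/min_y => w hw lw; exists w => //; exact: leq_trans lw.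
- exists y, v'; rewrite inE ys orbT; split=> // z.
  rewrite inE => /orP[/eqP -> | /min_y //].
  by exists v => //; exact: ltnW.
Qed.

(** If each of m colours j has m disjoint intervals, then disjoint intervals of
    all the colours can be selected.  Pick the first interval that ends
    earliest and discard the first interval of every other colour: what is left
    of these colours starts after the end of the picked interval, and each
    keeps m - 1 intervals. *)
Lemma rainbow_chain (T : eqType) (P : T -> nat -> nat -> Prop) h (s : seq T) :
  (forall j x y, P j x y -> x < y) ->
  (forall j, j \in s -> exists2 w, size s <= size w & chain (P j) h w) ->
  exists bx : seq (T * (nat * nat)),
    [/\ perm_eq (map fst bx) s, chain (fun x y => x < y) h (map snd bx) &
        forall B, B \in bx -> P B.1 B.2.1 B.2.2].
Proof.
move=> hP; elim: {s}(size s) {-2}s (erefl (size s)) h => [|m IH] s sz h hs.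
  by exists [::]; rewrite (size0nil sz).
pose H j v := exists I w, [/\ I.2 = v, m <= size w & chain (P j) h (I :: w)].
have [||j [v [js [I [w [Iv sw [hI PI cw]]]] min_v]]] := @exists_minimal_value _ H s.
- by case: (s) sz.
- move=> j /hs[]; rewrite sz => -[|I w] //= sw cw.
  by exists I.2, I, w.
have perm_s := perm_to_rem js.
have sz_rem : size (rem j s) = m by rewrite size_rem // sz.
have [|bx [perm_bx chain_bx P_bx]] := IH _ sz_rem v.
  move=> k /mem_rem/min_v[_ [I' [w' [<- sw' [_ _ cw']]]] le_v].
  by exists w'; rewrite ?sz_rem //; exact: chain_weaken le_v cw'.
exists ((j, I) :: bx); split.
- by rewrite perm_sym (perm_trans perm_s) //= perm_cons perm_sym.
- by rewrite /= Iv; split=> //; rewrite -Iv; exact: hP PI.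
- by move=> B; rewrite inE => /orP[/eqP -> | /P_bx].
Qed.

(** * Independent nonmonotone boxes *)

(** The entry x of a sum of a blocks of length two belongs to block x./2, and is
    sent to q or p of that block according to its parity. *)
Lemma contains_of_pairs a n (pi : 'S_n) (sigma : 'S_(a * 2)) (p q : 'I_a -> 'I_n) :
  (forall i, p i < q i) -> (forall i j : 'I_a, i < j -> q i < p j) ->
  (forall (x y : 'I_(a * 2)) (i j : 'I_a), i = x./2 :> nat -> j = y./2 :> nat ->
     sigma x < sigma y ->
     pi (if odd x then q i else p i) < pi (if odd y then q j else p j)) ->
  perm_contains sigma pi.
Proof.
have half_lt (x : 'I_(a * 2)) : x./2 < a by case: x => x /= hx; lia.
move=> lpq lqp hs; pose h x := Ordinal (half_lt x).
exists (fun x : 'I_(a * 2) => if odd x then q (h x) else p (h x)); split=> x y.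
- move=> lxy; have [lh | eh] : x./2 < y./2 \/ x./2 = y./2 by lia.
  + have lqp_h := lqp (h x) (h y) lh; have := lpq (h x); have := lpq (h y).
    by case: (odd x); case: (odd y); lia.
  + have [-> ->] : odd x = false /\ odd y by lia.
    have -> : h y = h x by exact: val_inj.
    exact: lpq.
- apply/idP/idP => [|lt_pi]; first exact: hs.
  case: ltngtP => // [lt_s | /val_inj/perm_inj exy].
  + have := hs y x (h y) (h x) erefl erefl lt_s; lia.
  + by rewrite exy ltnn in lt_pi.
Qed.

Definition has_asc n (pi : 'S_n) c1 c2 r1 r2 : bool :=
  [exists p : 'I_n, exists q : 'I_n,
    [&& c1 <= p, p < q, q < c2, r1 <= pi p, pi p < pi q & pi q < r2]].

Definition has_desc n (pi : 'S_n) c1 c2 r1 r2 : bool :=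
  [exists p : 'I_n, exists q : 'I_n,
    [&& c1 <= p, p < q, q < c2, r1 <= pi q, pi q < pi p & pi p < r2]].

Definition nonmonotone n (pi : 'S_n) c1 c2 r1 r2 : bool :=
  has_asc pi c1 c2 r1 r2 && has_desc pi c1 c2 r1 r2.

Lemma nonmonotone_wide n (pi : 'S_n) c1 c2 r1 r2 :
  nonmonotone pi c1 c2 r1 r2 -> c1.+1 < c2 /\ r1.+1 < r2.
Proof. by case/andP=> /existsP[p /existsP[q]] h _; lia. Qed.

Lemma nonmonotone_sub n (pi : 'S_n) c1 c2 r1 r2 c1' c2' r1' r2' :
  c1' <= c1 -> c2 <= c2' -> r1' <= r1 -> r2 <= r2' ->
  nonmonotone pi c1 c2 r1 r2 -> nonmonotone pi c1' c2' r1' r2'.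
Proof.
move=> h1 h2 h3 h4.
move=> /andP[/existsP[p /existsP[q hpq]] /existsP[p' /existsP[q' hpq']]].
by apply/andP; split; apply/existsP; [exists p | exists p']; apply/existsP;
  [exists q | exists q']; lia.
Qed.

(** In the boxes bx below, as in the next lemmas, the first component is the
    interval of values and the second the interval of positions. *)
Lemma contains_dsum_iter21 n (pi : 'S_n) (bx : seq ((nat * nat) * (nat * nat))) :
  pairwise (fun B B' => (B.2.2 <= B'.2.1) && (B.1.2 <= B'.1.1)) bx ->
  (forall B, B \in bx -> has_desc pi B.2.1 B.2.2 B.1.1 B.1.2) ->
  perm_contains (dsum_iter perm21 (size bx)) pi.
Proof.
pose D := ((0, 0), (0, 0)); move=> /(pairwiseP D) sep hbx.
have /fin_all_exists2[p] : forall i : 'I_(size bx),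
    exists2 p : 'I_n, True & exists q : 'I_n,
    let B := nth D bx i in
    [&& B.2.1 <= p, p < q, q < B.2.2, B.1.1 <= pi q, pi q < pi p & pi p < B.1.2].
  move=> i; have /hbx/existsP[p /existsP[q hpq]] := mem_nth D (ltn_ord i).
  by exists p => //; exists q.
move=> _ /fin_all_exists[q hpq].
apply: (contains_of_pairs (p := p) (q := q)) => [i | i j lij | x y i j ex ey].
- by have := hpq i; lia.
- by have := hpq i; have := hpq j; have := sep i j (ltn_ord i) (ltn_ord j) lij; lia.
rewrite !dsum_iter21E -ex -ey => lxy.
have hi := hpq i; have hj := hpq j.
have [lij | [eij [ox oy]]] : i < j \/ (i = j :> nat /\ odd x /\ ~~ odd y) by lia.
- have := sep i j (ltn_ord i) (ltn_ord j) lij.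
  by case: (odd x); case: (odd y); lia.
- by rewrite ox (negPf oy) -(val_inj eij); lia.
Qed.

Lemma contains_ssum_iter12 n (pi : 'S_n) (bx : seq ((nat * nat) * (nat * nat))) :
  pairwise (fun B B' => (B.2.2 <= B'.2.1) && (B'.1.2 <= B.1.1)) bx ->
  (forall B, B \in bx -> has_asc pi B.2.1 B.2.2 B.1.1 B.1.2) ->
  perm_contains (ssum_iter perm12 (size bx)) pi.
Proof.
pose D := ((0, 0), (0, 0)); move=> /(pairwiseP D) sep hbx.
have /fin_all_exists2[p] : forall i : 'I_(size bx),
    exists2 p : 'I_n, True & exists q : 'I_n,
    let B := nth D bx i in
    [&& B.2.1 <= p, p < q, q < B.2.2, B.1.1 <= pi p, pi p < pi q & pi q < B.1.2].
  move=> i; have /hbx/existsP[p /existsP[q hpq]] := mem_nth D (ltn_ord i).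
  by exists p => //; exists q.
move=> _ /fin_all_exists[q hpq].
apply: (contains_of_pairs (p := p) (q := q)) => [i | i j lij | x y i j ex ey].
- by have := hpq i; lia.
- by have := hpq i; have := hpq j; have := sep i j (ltn_ord i) (ltn_ord j) lij; lia.
rewrite !ssum_iter12E -ex -ey => lxy.
have hi := hpq i; have hj := hpq j; have li := ltn_ord i; have lj := ltn_ord j.
have [lji | [eij [ox oy]]] : j < i \/ (i = j :> nat /\ ~~ odd x /\ odd y) by lia.
- have := sep j i lj li lji.
  by case: (odd x); case: (odd y); lia.
- by rewrite (negPf ox) oy -(val_inj eij); lia.
Qed.

(** The rainbow selection has the row strips as its colours.  It orders the
    selected boxes by columns, so that an ascending or descending subsequence
    of their rows yields the two kinds of sums. *)
Lemma contains_of_row_chain n (pi : 'S_n) a b rows :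
  2 ^ (b + a) <= size rows ->
  chain (fun x y => exists2 w, size w = size rows &
           chain (fun c d => nonmonotone pi c d x y) 0 w) 0 rows ->
  perm_contains (dsum_iter perm21 b) pi \/ perm_contains (ssum_iter perm12 a) pi.
Proof.
move=> N_le hrows.
have N_gt0 : 0 < size rows by apply: leq_trans N_le; rewrite expn_gt0.
case/chain_pairwise: hrows => [x y [[|J w] sw] | _ sep_rows bad_rows].
- by rewrite -sw in N_gt0.
- by case=> _ /nonmonotone_wide[_ h] _; lia.
have [||bx [perm_bx chain_bx bad_bx]] :=
    @rainbow_chain _ (fun J c d => nonmonotone pi c d J.1 J.2) 0 rows.
- by move=> J x y /nonmonotone_wide[h _]; lia.
- by move=> J /bad_rows[w sw cw]; exists w; rewrite ?sw.
case/chain_pairwise: chain_bx => [x y /ltnW // | _ cols_bx _].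
rewrite pairwise_map in cols_bx.
have le_bx : 2 ^ (b + a) <= size bx by rewrite -(size_map fst) (perm_size perm_bx).
have [[t [<- pt ts]] | [t [<- pt ts]]] :=
    ramsey_pairwise (fun B B' => B.1.2 <= B'.1.1) le_bx; [left | right].
- apply: contains_dsum_iter21.
    by rewrite pairwise_relI (subseq_pairwise ts cols_bx).
  by move=> B /(mem_subseq ts)/bad_bx/andP[].
- apply: contains_ssum_iter12; last by move=> B /(mem_subseq ts)/bad_bx/andP[].
  rewrite pairwise_relI (subseq_pairwise ts cols_bx) /=.
  (* Two disjoint strips not in ascending order are in descending order. *)
  have uniq_rows : uniq rows.
    rewrite uniq_pairwise; apply: (sub_in_pairwise _ (allss _) sep_rows).
    move=> J J' /bad_rows[[|I w] sw cw] _ /= sep; first by rewrite -sw in N_gt0.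
    case: cw => _ /nonmonotone_wide[_ h] _.
    by apply/eqP => e; rewrite -e leqNgt (ltnW h) in sep.
  have uniq_t : uniq (map fst t).
    apply: subseq_uniq (map_subseq _ ts) _.
    by rewrite (perm_uniq perm_bx).
  rewrite uniq_pairwise pairwise_map in uniq_t.
  have := conj pt uniq_t => /andP; rewrite -pairwise_relI.
  move=> /sub_in_pairwise; apply; last exact: allss.
  move=> B B' Bt B't /= /andP[nle neq].
  have rows_of C : C \in t -> C.1 \in rows.
    by move=> /(mem_subseq ts) Cb; rewrite -(perm_mem perm_bx) map_f.
  have := pairwise_or_sym sep_rows (rows_of _ Bt) (rows_of _ B't) neq.
  by rewrite (negPf nle).
Qed.

(** * Assembling the gridding *)

Lemma monotone_subseq_perm n (pi : 'S_n) c1 c2 r1 r2 :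
  ~~ nonmonotone pi c1 c2 r1 r2 ->
  let s := subseq_perm pi (ord_itv n c1 c2) (ord_itv n r1 r2) in
  ~~ sorted ltn s -> sorted gtn s.
Proof.
have gtn_trans : transitive gtn by move=> x y z /=; lia.
move=> mono s not_inc; apply/(subseq_perm_sorted _ _ _ gtn_trans) => p q.
rewrite !inE => cp cq rp rq lpq /=; rewrite ltnNge; apply/negP => le_pq.
have lt_pq : pi p < pi q.
  by rewrite ltn_neqAle le_pq andbT (inj_eq val_inj) (inj_eq perm_inj) neq_ltn lpq.
case/negP: not_inc; apply/(subseq_perm_sorted _ _ _ ltn_trans) => p' q'.
rewrite !inE => cp' cq' rp' rq' lpq'; rewrite ltn_neqAle.
rewrite (inj_eq val_inj) (inj_eq perm_inj) neq_ltn lpq' /= leqNgt.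
apply: contra mono => lt_qp; apply/andP; split; apply/existsP.
- by exists p; apply/existsP; exists q; lia.
- by exists p'; apply/existsP; exists q'; lia.
Qed.

(** Each strip comes with its own vertical cuts; the grid uses all of them.
    The N cuts of each of the N strips and the lines 0 and n bound N * N + 1
    columns. *)
Lemma griddable_of_slicings n (pi : 'S_n) N rows :
  size rows = N ->
  slicing (fun x y => exists2 s, size s = N &
             slicing (fun c d => ~~ nonmonotone pi c d x y) 0 s n) 0 rows n ->
  perm_griddable (N * N).+1 N pi.
Proof.
move=> sz_rows; case/slicing_grid => sorted_rows last_rows.
rewrite sz_rows => strips.
have /fin_all_exists2[cuts sz_cuts hcuts] (l : 'I_N) : exists2 s, size s = N &
    slicing (fun c d =>
      ~~ nonmonotone pi c d (nth 0 (0 :: rows) l) (nth 0 rows l)) 0 s n.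
  exact: strips.
pose all_cuts := flatten [seq cuts l | l <- enum 'I_N].
have sz_all : size all_cuts = N * N.
  rewrite size_flatten /shape -map_comp (eq_map (g := fun=> N)); last first.
    by move=> l /=; exact: sz_cuts.
  by rewrite sumnE big_map big_enum sum_nat_const card_ord.
pose cols := 0 :: rcons (sort leq all_cuts) n.
have le_n z : z \in all_cuts -> z <= n.
  case/flattenP => s /mapP[l _ ->]; exact: slicing_le (hcuts l).
have sorted_cols : sorted leq cols.
  rewrite /cols /= rcons_path path_min_sorted ?(sort_sorted leq_total);
    last by apply/allP.
  have := mem_last 0 (sort leq all_cuts).
  by rewrite inE mem_sort => /orP[/eqP -> // | /le_n].
have sz_cols : size cols = (N * N).+2 by rewrite /= size_rcons size_sort sz_all.
have sz_rows' : size (0 :: rows) = N.+1 by rewrite /= sz_rows.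
pose c : (N * N).+2.-tuple nat := Tuple (introT eqP sz_cols).
pose r : N.+1.-tuple nat := Tuple (introT eqP sz_rows').
pose cell k l R := sorted R (subseq_perm pi (ord_itv n (nth 0 c k) (nth 0 c k.+1))
                              (ord_itv n (nth 0 r l) (nth 0 r l.+1))).
exists (\matrix_(k, l) if cell k l ltn then 1 else -1)%R; split.
  by move=> k l; rewrite mxE; case: ifP; rewrite !inE eqxx ?orbT.
exists c, r; split.
- by split=> //; rewrite /= nth_rcons size_sort sz_all ltnn eqxx.
- by split=> //; rewrite /= -last_rows (last_nth 0) sz_rows.
move=> k l; rewrite mxE /= -/(cell k l ltn).
have mono : ~~ nonmonotone pi (nth 0 c k) (nth 0 c k.+1) (nth 0 r l) (nth 0 r l.+1).
  apply/negP => bad; have [wide_c _] := nonmonotone_wide bad.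
  have lt_k : k.+1 < size cols by rewrite sz_cols ltnS.
  have le_cols i j : i <= j -> j < size cols -> nth 0 cols i <= nth 0 cols j.
    move=> lij lj; apply: (sorted_leq_nth leq_trans leqnn) => //; rewrite inE //.
    exact: leq_ltn_trans lj.
  have [||z z_cut|d [e [mono_de led lee]]] :=
      slicing_sub (x := nth 0 c k) (y := nth 0 c k.+1) (hcuts l) _ (ltnW wide_c).
  - by [].
  - suff : all (fun z => z <= n) cols by move/(all_nthP 0); apply.
    by rewrite /= all_rcons leqnn; apply/allP => z; rewrite mem_sort => /le_n.
  - have : z \in cols.
      rewrite inE mem_rcons inE mem_sort; apply/or3P/Or33.
      by apply/flattenP; exists (cuts l) => //; apply: map_f; rewrite mem_enum.
    case/(nthP 0) => i li <-; case: (leqP i k) => hik; [left | right].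
      by apply: le_cols => //; exact: ltnW.
    exact: le_cols.
  - by case/negP: mono_de; apply: nonmonotone_sub bad.
case: ifP => [cell_inc | /negbT cell_ninc]; split=> //.
by move=> _; exact: monotone_subseq_perm.
Qed.

Lemma perm_griddable_or_contains n (pi : 'S_n) a b :
  let N := 2 ^ (b + a) in
  [\/ perm_griddable (N * 2 * (N * 2)).+1 (N * 2) pi,
      perm_contains (dsum_iter perm21 b) pi |
      perm_contains (ssum_iter perm12 a) pi].
Proof.
move=> N; have N_gt0 : 0 < N by rewrite expn_gt0.
pose many x y := exists2 w, size w = N &
  chain (fun c d => nonmonotone pi c d x y) 0 w.
pose few x y := exists2 s, size s = N * 2 &
  slicing (fun c d => ~~ nonmonotone pi c d x y) 0 s n.
have many_wide x y : many x y -> x.+1 < y.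
  by case=> -[|J w] sw; [rewrite -sw in N_gt0 | case=> _ /nonmonotone_wide[]].
have many_or_few x y : x <= y -> many x y \/ few x y.
  move=> _; apply: chain_or_slicing => // [c d /nonmonotone_wide[] // | c d _].
  by case: nonmonotone; [left | right].
have [[w sw cw] | [s ss cs]] :=
    chain_or_slicing N many_wide many_or_few (leq0n n).
- by case: (@contains_of_row_chain n pi a b w); rewrite ?sw //;
    [constructor 2 | constructor 3].
- by constructor 1; apply: griddable_of_slicings cs.
Qed.

Theorem theorem2p5 (C : permset) (hC : perm_class C) :
  class_griddable C <->
  (exists a : nat, 0 < a /\ ~ C (a * 2) (ssum_iter perm12 a)) /\
  (exists b : nat, 0 < b /\ ~ C (b * 2) (dsum_iter perm21 b)).
Proof.
split=> [[t [u [_ _ grid]]] | [[a [_ noa]] [b [_ nob]]]].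
  split; exists (2 * (t * u).+1); split=> // /grid.
  - exact: ssum_iter12_not_griddable.
  - exact: dsum_iter21_not_griddable.
pose N := 2 ^ (b + a).
exists (N * 2 * (N * 2)).+1, (N * 2); split=> //.
  by rewrite muln_gt0 expn_gt0.
move=> n pi Cpi; case: (perm_griddable_or_contains pi a b) => // h.
- by case: nob; exact: hC h.
- by case: noa; exact: hC h.
Qed.
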